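(* Let $\gamma$ be Euler's constant, let $\psi_L=\sum_{i=1}^\infty 1/L_i$, and let $GS_j^{(H)} = \sum_{k=L_j+1}^{L_{j+1}-1}\frac1k$. Then $$\gamma = \psi_L - \ln(\alpha) + \sum_{j=1}^{\infty}\bigl(GS_j^{(H)} - \ln(\alpha)\bigr),$$ equivalently, $$\gamma = \psi_L - \ln(\alpha) + \sum_{j=1}^{\infty}\Bigl(H_{L_{j+1}-1} - H_{L_j} - \ln(\alpha)\Bigr).$$
   Context: $L_n$ ($n\ge1$) are the Lucas numbers: $L_1=1$, $L_2=3$, $L_n=L_{n-1}+L_{n-2}$ for $n\ge3$. $\alpha = \frac{1+\sqrt5}{2}$ is the golden ratio. $H_k=\sum_{i=1}^k\frac1i$ is the $k$-th harmonic number. Empty sums are $0$. *)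

(* Defs.v *)
(* Stdlib reals with Coquelicot. *)
From Stdlib Require Import Reals Lra Lia.
From Coquelicot Require Import Coquelicot.
Open Scope R_scope.

(* Only the values at n >= 1 are the Lucas numbers of the text;
   [lucas 0 = 2] is the extension compatible with the recurrence. *)
Fixpoint lucas (n : nat) : nat :=
  match n with
  | 0 => 2
  | S m => match m with
           | 0 => 1
           | S p => lucas m + lucas p
           end
  end%nat.

Definition alpha : R := (1 + sqrt 5) / 2.

(* [sum_n_m a n m] is the sum over n <= k <= m, equal to 0 when m < n. *)
Definition harmonic (k : nat) : R := sum_n_m (fun i => / INR i) 1 k.

(* Coquelicot's [Lim_seq] is total; [is_lim_euler_gamma] below shows that here
   it is a genuine finite limit. *)
Definition euler_gamma : R := real (Lim_seq (fun n => harmonic n - ln (INR n))).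

(* Coquelicot's series start at index 0, hence the shift by [S] here and in
   every sum over i >= 1. *)
Definition psi_L : R := Series (fun i => / INR (lucas (S i))).

Definition GS_H (j : nat) : R :=
  sum_n_m (fun k => / INR k) (lucas j + 1) (lucas (j + 1) - 1).

Lemma harmonic_S (n : nat) : harmonic (S n) = harmonic n + / INR (S n).
Proof. unfold harmonic; rewrite sum_n_Sm; [reflexivity | lia]. Qed.

Lemma ln_le_sub1 (x : R) : 0 < x -> ln x <= x - 1.
Proof.
  intros Hx.
  pose proof (exp_ineq1_le (ln x)) as H.
  rewrite exp_ln in H by exact Hx; lra.
Qed.

Lemma ln_INR_S_bounds (n : nat) :
  / INR (S (S n)) <= ln (INR (S (S n))) - ln (INR (S n)) <= / INR (S n).
Proof.
  assert (Hp : 0 < INR (S n)) by (apply lt_0_INR; lia).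
  rewrite (S_INR (S n)); set (x := INR (S n)) in *.
  split.
  - assert (H := ln_le_sub1 (x / (x + 1)) ltac:(apply Rdiv_lt_0_compat; lra)).
    rewrite ln_div in H by lra.
    replace (x / (x + 1) - 1) with (- / (x + 1)) in H by (field; lra); lra.
  - assert (H := ln_le_sub1 ((x + 1) / x) ltac:(apply Rdiv_lt_0_compat; lra)).
    rewrite ln_div in H by lra.
    replace ((x + 1) / x - 1) with (/ x) in H by (field; lra); lra.
Qed.

Lemma ln_le_harmonic (n : nat) : ln (INR (S (S n))) <= harmonic (S n).
Proof.
  induction n as [|n IH].
  - pose proof (ln_INR_S_bounds 0) as [_ H].
    change (INR 1) with 1 in H; rewrite ln_1 in H.
    unfold harmonic; rewrite sum_n_n; change (INR 1) with 1; lra.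
  - rewrite harmonic_S; pose proof (ln_INR_S_bounds (S n)); lra.
Qed.

Lemma is_lim_euler_gamma :
  is_lim_seq (fun n => harmonic n - ln (INR n)) euler_gamma.
Proof.
  assert (H : ex_finite_lim_seq
                (fun n => harmonic (S n) - ln (INR (S n)))).
  { apply (ex_finite_lim_seq_decr _ 0); intros n.
    - rewrite (harmonic_S (S n)); pose proof (ln_INR_S_bounds n); lra.
    - pose proof (ln_le_harmonic n).
      assert (ln (INR (S n)) <= ln (INR (S (S n)))).
      { apply ln_le; [apply lt_0_INR; lia | apply le_INR; lia]. }
      lra. }
  apply Lim_seq_correct'.
  destruct H as [l Hl]; exists l.
  now apply is_lim_seq_incr_1.
Qed.

(* Main.v *)
Require Import Defs.
From Stdlib Require Import Reals Lra Lia.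
From Coquelicot Require Import Coquelicot.
Open Scope R_scope.

(** The integers from [1] to [lucas (n + 1)] consist of the Lucas numbers
    [lucas 1, ..., lucas (n + 1)] and of the gaps between consecutive ones.
    Splitting the harmonic sum accordingly, the partial sums satisfy
    [[
      sum_(1 <= j <= n) (GS_H j - ln alpha)
        = (harmonic L - ln L) - sum_(1 <= i <= n+1) / lucas i
          + (ln L - (n + 1) ln alpha) + ln alpha      with L = lucas (n + 1).
    ]]
    The first bracket is a subsequence of the sequence that defines Euler's
    constant ([is_lim_euler_gamma]); the reciprocal sum tends to [psi_L], since
    the Lucas numbers dominate the powers of [alpha > 1] ([ex_series_inv_lucas]);
    and the last bracket tends to [0], since Binet's formula gives
    [lucas n ~ alpha ^ n] ([is_lim_ln_lucas]).  Hence the series converges to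
    [euler_gamma - psi_L + ln alpha].  The second form has the same terms:
    a gap sum is a difference of harmonic numbers ([GS_H_harmonic]). *)

Lemma lucas_SS (n : nat) :
  lucas (S (S n)) = (lucas (S n) + lucas n)%nat.
Proof. reflexivity. Qed.

Lemma lucas_pos (n : nat) : (0 < lucas n)%nat.
Proof.
  enough (0 < lucas n /\ 0 < lucas (S n))%nat by tauto.
  induction n as [|n IH]; [simpl; lia | rewrite lucas_SS; lia].
Qed.

Lemma lucas_S_lt (n : nat) : (lucas (S n) < lucas (S (S n)))%nat.
Proof. rewrite lucas_SS; pose proof (lucas_pos n); lia. Qed.

Lemma alpha_gt_1 : 1 < alpha.
Proof.
  unfold alpha; pose proof (sqrt_lt_1 1 5 ltac:(lra) ltac:(lra) ltac:(lra)) as H.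
  rewrite sqrt_1 in H; lra.
Qed.

Lemma alpha_sqr : alpha * alpha = alpha + 1.
Proof.
  unfold alpha; pose proof (sqrt_sqrt 5 ltac:(lra)); nra.
Qed.

(** The second root of [x ^ 2 = x + 1] appears as [1 - alpha], the two roots
    having sum [1]. *)
Lemma lucas_binet (n : nat) :
  INR (lucas n) = alpha ^ n + (1 - alpha) ^ n.
Proof.
  enough (INR (lucas n) = alpha ^ n + (1 - alpha) ^ n /\
          INR (lucas (S n)) = alpha ^ S n + (1 - alpha) ^ S n) by tauto.
  induction n as [|n [IH0 IH1]]; [simpl; lra|].
  split; [exact IH1|].
  rewrite lucas_SS, plus_INR, IH0, IH1; simpl.
  pose proof alpha_sqr as Ha.
  replace (alpha * (alpha * alpha ^ n)) with ((alpha + 1) * alpha ^ n)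
    by (rewrite <- Ha; ring).
  replace ((1 - alpha) * ((1 - alpha) * (1 - alpha) ^ n))
    with ((2 - alpha) * (1 - alpha) ^ n)
    by (replace (2 - alpha) with ((1 - alpha) * (1 - alpha)) by nra; ring).
  ring.
Qed.

(** Both sides satisfy the Fibonacci recurrence, so the bound propagates from
    the first two indices. *)
Lemma pow_alpha_le_lucas (n : nat) : alpha ^ n <= INR (lucas (S n)).
Proof.
  enough (alpha ^ n <= INR (lucas (S n)) /\
          alpha ^ S n <= INR (lucas (S (S n)))) by tauto.
  pose proof alpha_gt_1 as H1; pose proof alpha_sqr as Ha.
  induction n as [|n [IH0 IH1]].
  - simpl; split; [lra | nra].
  - split; [exact IH1|].
    rewrite (lucas_SS (S n)), plus_INR.
    replace (alpha ^ S (S n)) with (alpha ^ S n + alpha ^ n); [lra|].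
    simpl; rewrite <- Rmult_assoc, Ha; ring.
Qed.

Lemma ex_series_inv_lucas : ex_series (fun i : nat => / INR (lucas (S i))).
Proof.
  pose proof alpha_gt_1 as H1.
  apply (ex_series_le (K := R_AbsRing) (V := R_CompleteNormedModule))
    with (b := fun i => (/ alpha) ^ i).
  - intros i.
    pose proof (lt_0_INR _ (lucas_pos (S i))).
    change (Rabs (/ INR (lucas (S i))) <= (/ alpha) ^ i).
    rewrite Rabs_pos_eq by (left; now apply Rinv_0_lt_compat).
    rewrite pow_inv.
    apply Rinv_le_contravar; [apply pow_lt; lra | apply pow_alpha_le_lucas].
  - apply ex_series_geom.
    rewrite Rabs_pos_eq by (left; apply Rinv_0_lt_compat; lra).
    rewrite <- Rinv_1; apply Rinv_lt_contravar; lra.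
Qed.

(** By Binet's formula [lucas n / alpha ^ n = 1 + ((1 - alpha) / alpha) ^ n],
    whose geometric term has ratio smaller than [1] in absolute value. *)
Lemma is_lim_ln_lucas :
  is_lim_seq (fun n => ln (INR (lucas n)) - INR n * ln alpha) 0.
Proof.
  pose proof alpha_gt_1 as H1.
  set (q := (1 - alpha) / alpha).
  apply is_lim_seq_ext with (fun n => ln (1 + q ^ n)).
  - intros n.
    pose proof (lt_0_INR _ (lucas_pos n)) as HL.
    assert (Hp : 0 < alpha ^ n) by (apply pow_lt; lra).
    replace (1 + q ^ n) with (INR (lucas n) / alpha ^ n).
    + rewrite ln_div by assumption. rewrite ln_pow by lra; reflexivity.
    + rewrite lucas_binet; unfold q, Rdiv; rewrite Rpow_mult_distr, pow_inv.
      field; lra.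
  - rewrite <- ln_1.
    apply is_lim_seq_continuous with (u := fun n => 1 + q ^ n).
    + apply derivable_continuous_pt; exists (/ 1); apply derivable_pt_lim_ln; lra.
    + replace (Finite 1) with (Finite (1 + 0)) by (f_equal; lra).
      apply is_lim_seq_plus'; [apply is_lim_seq_const|].
      apply is_lim_seq_geom.
      unfold q; rewrite Rabs_left.
      * apply (Rmult_lt_reg_r alpha); [lra|]. field_simplify; lra.
      * apply (Rmult_lt_reg_r alpha); [lra|]. field_simplify; lra.
Qed.

(** Starting at index [1] matters: [lucas 0 > lucas 1], and the difference of
    harmonic numbers is a sum over the gap only between increasing endpoints. *)
Lemma GS_H_harmonic (j : nat) :
  GS_H (S j) = harmonic (lucas (S j + 1) - 1) - harmonic (lucas (S j)).
Proof.
  pose proof (lucas_S_lt j) as Hlt.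
  unfold GS_H, harmonic.
  replace (S j + 1)%nat with (S (S j)) by lia.
  replace (lucas (S j) + 1)%nat with (S (lucas (S j))) by lia.
  rewrite (sum_n_m_Chasles _ 1 (lucas (S j)) (lucas (S (S j)) - 1)) by lia.
  symmetry; apply Rplus_minus_l.
Qed.

Lemma harmonic_lucas_SS (n : nat) :
  harmonic (lucas (S (S n))) =
    harmonic (lucas (S n)) + GS_H (S n) + / INR (lucas (S (S n))).
Proof.
  rewrite GS_H_harmonic.
  replace (S n + 1)%nat with (S (S n)) by lia.
  pose proof (lucas_pos (S (S n))).
  destruct (lucas (S (S n))) as [|m]; [lia|].
  rewrite harmonic_S.
  replace (S m - 1)%nat with m by lia; ring.
Qed.

(** Telescoping: each step adds to [harmonic] one gap and the Lucas number that
    closes it.  The reciprocal sum has one term more than the gap sum, because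
    [n] gaps separate [n + 1] Lucas numbers. *)
Lemma sum_GS_H (n : nat) :
  sum_n (fun j => GS_H (S j) - ln alpha) n =
    harmonic (lucas (S (S n)))
    - sum_n (fun i => / INR (lucas (S i))) (S n) - INR (S n) * ln alpha.
Proof.
  induction n as [|n IH].
  - rewrite sum_Sn, !sum_O, harmonic_lucas_SS.
    unfold plus, harmonic; simpl; rewrite sum_n_n; simpl; ring.
  - rewrite sum_Sn, IH, (sum_Sn _ (S n)), (harmonic_lucas_SS (S n)), (S_INR (S n)).
    unfold plus; simpl; ring.
Qed.

Lemma is_series_GS_H :
  is_series (fun j => GS_H (S j) - ln alpha) (euler_gamma - psi_L + ln alpha).
Proof.
  change (is_lim_seq (sum_n (fun j => GS_H (S j) - ln alpha))
            (euler_gamma - psi_L + ln alpha)).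
  (* Adding and subtracting [ln (lucas (n + 2))] separates the three limits; the
     final [ln alpha] compensates for the gaps being one fewer than the powers
     of [alpha] in [lucas (n + 2) ~ alpha ^ (n + 2)]. *)
  apply is_lim_seq_ext with
    (fun n => (harmonic (lucas (S (S n))) - ln (INR (lucas (S (S n)))))
              - sum_n (fun i => / INR (lucas (S i))) (S n)
              + ((ln (INR (lucas (S (S n)))) - INR (S (S n)) * ln alpha)
                 + ln alpha)).
  { intros n; rewrite sum_GS_H, (S_INR (S n)); ring. }
  replace (euler_gamma - psi_L + ln alpha)
    with (euler_gamma - psi_L + (0 + ln alpha)) by ring.
  apply is_lim_seq_plus'; [apply is_lim_seq_minus' | apply is_lim_seq_plus'].
  - apply (is_lim_seq_subseq (fun k => harmonic k - ln (INR k)) euler_gamma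
             (fun n => lucas (S (S n)))).
    + apply eventually_subseq; intros n; apply lucas_S_lt.
    + apply is_lim_euler_gamma.
  - apply -> (is_lim_seq_incr_1 (sum_n (fun i => / INR (lucas (S i))))).
    exact (Series_correct _ ex_series_inv_lucas).
  - apply is_lim_seq_ext with
      (fun n => ln (INR (lucas (n + 2))) - INR (n + 2) * ln alpha).
    + intros n; replace (n + 2)%nat with (S (S n)) by lia; reflexivity.
    + apply -> (is_lim_seq_incr_n
                (fun n => ln (INR (lucas n)) - INR n * ln alpha) 2).
      apply is_lim_ln_lucas.
  - apply is_lim_seq_const.
Qed.

Theorem proposition4p14 :
  ex_series (fun i : nat => / INR (lucas (S i))) /\
  (ex_series (fun j : nat => GS_H (S j) - ln alpha) /\
   euler_gamma =
     psi_L - ln alpha + Series (fun j : nat => GS_H (S j) - ln alpha)) /\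
  (ex_series (fun j : nat =>
     harmonic (lucas (S j + 1) - 1) - harmonic (lucas (S j)) - ln alpha) /\
   euler_gamma =
     psi_L - ln alpha +
     Series (fun j : nat =>
       harmonic (lucas (S j + 1) - 1) - harmonic (lucas (S j)) - ln alpha)).
Proof.
  pose proof is_series_GS_H as H.
  assert (H' : is_series (fun j : nat =>
     harmonic (lucas (S j + 1) - 1) - harmonic (lucas (S j)) - ln alpha)
     (euler_gamma - psi_L + ln alpha)).
  { refine (is_series_ext _ _ _ _ H); intros j.
    now rewrite GS_H_harmonic. }
  split; [exact ex_series_inv_lucas|].
  split; split.
  - now exists (euler_gamma - psi_L + ln alpha).
  - rewrite (is_series_unique _ _ H); ring.
  - now exists (euler_gamma - psi_L + ln alpha).
  - rewrite (is_series_unique _ _ H'); ring.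
Qed.
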